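(* For all integers $k,r$ with $r\geq0$, the family of binomial coefficients $\binom{kp}{rp}$ (indexed by primes $p$) is asymptotically representable.
   Context: A composition is a finite ordered tuple $\mathbf{s}=(s_1,\ldots,s_k)$ of positive integers (empty allowed), weight $w(\mathbf{s})=\sum s_i$; $H_n(\mathbf{s})=\sum_{n\geq n_1>\cdots>n_k\geq1}n_1^{-s_1}\cdots n_k^{-s_k}$, $H_n(\varnothing)=1$. A collection $a_p\in\mathbb{Z}_p$ (defined for all but finitely many primes $p$) is asymptotically representable if there are coefficients $\alpha_{\mathbf{s}}\in\mathbb{Q}$, one for each composition and independent of $p$, such that for every $n\geq1$ the congruence $a_p\equiv\sum_{w(\mathbf{s})<n}\alpha_{\mathbf{s}}p^{w(\mathbf{s})}H_{p-1}(\mathbf{s})\pmod{p^n}$ holds for all sufficiently large $p$. *)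

(* Defs.v *)
From mathcomp Require Import all_boot all_order all_algebra.
From mathcomp Require Import ring.

Set Implicit Arguments.
Unset Strict Implicit.
Unset Printing Implicit Defensive.

Import Order.TTheory GRing.Theory Num.Theory.
Local Open Scope ring_scope.

Definition is_composition (s : seq nat) : bool := all (leq 1) s.

Definition weight (s : seq nat) : nat := sumn s.

(* A composition of weight < n has fewer than n parts, each of them < n, so it
   is the list of values of a tuple of elements of 'I_n of length < n. *)
Definition compositions_lt (n : nat) : seq (seq nat) :=
  [seq s <- flatten [seq [seq map val t | t : k.-tuple 'I_n] | k <- iota 0 n]
   | is_composition s & (weight s < n)%N].

Lemma leq_size_weight (s : seq nat) : is_composition s -> (size s <= weight s)%N.
Proof.
by elim: s => //= x s IH /andP[x0 /IH]; rewrite -add1n; exact: leq_add.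
Qed.

Lemma leq_part_weight (s : seq nat) (x : nat) : x \in s -> (x <= weight s)%N.
Proof.
elim: s => //= y s IH; rewrite inE => /orP[/eqP-> | /IH xs].
  exact: leq_addr.
exact: leq_trans xs (leq_addl _ _).
Qed.

Lemma mem_compositions_lt (n : nat) (s : seq nat) :
  (s \in compositions_lt n) = is_composition s && (weight s < n)%N.
Proof.
rewrite mem_filter; apply: andb_idr => /andP[cs ws].
have [n' ?] : exists n', n = n'.+1 by case: n ws => // n' _; exists n'.
subst n; apply/flattenP; exists [seq map val t | t : (size s).-tuple 'I_n'.+1].
  apply/mapP; exists (size s) => //.
  by rewrite mem_iota /= add0n (leq_ltn_trans (leq_size_weight cs)).
apply/mapP; exists (map_tuple (@inord n') (in_tuple s)); first exact: mem_enum.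
rewrite /= -map_comp -[LHS]map_id; apply/eq_in_map => x xs /=.
by rewrite inordK // (leq_ltn_trans (leq_part_weight xs)).
Qed.

Lemma uniq_compositions_lt (n : nat) : uniq (compositions_lt n).
Proof.
apply: filter_uniq.
have : uniq (iota 0 n) by exact: iota_uniq.
elim: (iota 0 n) => //= k l IH /andP[kl ul].
rewrite cat_uniq IH // andbT; apply/andP; split.
  rewrite map_inj_uniq ?enum_uniq // => t u /(inj_map val_inj) tu.
  exact: val_inj.
apply/hasPn => _ /flattenP[_ /mapP[j jl ->] /mapP[t _ ->]].
apply: contra kl => /mapP[u _ /(congr1 size)].
by rewrite !size_map !size_tuple => <-.
Qed.

(* The tuple t = (n_1, ..., n_k) ranges over n >= n_1 > ... > n_k >= 1. *)
Definition mhs (n : nat) (s : seq nat) : rat :=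
  \sum_(t : (size s).-tuple 'I_n.+1
        | sorted gtn (map val t) && all (leq 1) (map val t))
     \prod_(i < size s) (tnth t i : nat)%:R ^- nth 0%N s i.

Lemma mhs_nil (n : nat) : mhs n [::] = 1.
Proof.
rewrite /mhs (big_pred1 [tuple]); first by rewrite big_ord0.
by move=> t; rewrite (tuple0 t) /=.
Qed.

(* The ring Z_p as the inverse limit of the Z/p^n: the n-th term is the
   representative in [0, p^n) of the residue class modulo p^n. *)
Record padic_int (p : nat) := PadicInt {
  padic_res :> nat -> int;
  padic_resP : forall n, padic_res n = (padic_res n.+1 %% p%:Z ^+ n)%Z }.

Fact padic_of_int_subproof (p : nat) (m : int) (n : nat) :
  (m %% p%:Z ^+ n)%Z = ((m %% p%:Z ^+ n.+1)%Z %% p%:Z ^+ n)%Z.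
Proof.
apply/eqP; rewrite eqz_mod_dvd {1}(divz_eq m (p%:Z ^+ n.+1)) addrK exprS.
by rewrite mulrA dvdz_mull.
Qed.

Definition padic_of_int (p : nat) (m : int) : padic_int p :=
  @PadicInt p (fun n => (m %% p%:Z ^+ n)%Z) (padic_of_int_subproof p m).

(* Membership in the localization of the integers at the prime p. *)
Definition p_integral (p : nat) (q : rat) : bool := ~~ (p %| `|denq q|)%N.

(* a = q modulo p^n Z_p.  The integer a n is congruent to a modulo p^n, so this
   says that q - a n lies in p^n Z_p; for rationals that is p^n times the
   localization at p.  In particular it forces q to be p-integral. *)
Definition padic_eqmod (p n : nat) (a : padic_int p) (q : rat) : Prop :=
  p_integral p ((q - (a n)%:~R) / p%:R ^+ n).

(* Only the values of a at large primes, and of alpha at compositions, matter;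
   a family defined for almost all primes may be extended arbitrarily. *)
Definition asymptotically_representable (a : forall p : nat, padic_int p) : Prop :=
  exists alpha : seq nat -> rat,
  forall n : nat, (1 <= n)%N ->
  exists N : nat, forall p : nat, prime p -> (N <= p)%N ->
    padic_eqmod n (a p)
      (\sum_(s <- compositions_lt n)
         alpha s * p%:R ^+ weight s * mhs p.-1 s).

(* x (x - 1) ... (x - m + 1) / m!; the division is exact by binz_fact. *)
Definition binz (x : int) (m : nat) : int :=
  ((\prod_(i < m) (x - i%:Z)) %/ (m`!)%:Z)%Z.

Lemma prod_subz_nat (x m : nat) : \prod_(i < m) (x%:Z - i%:Z) = (x ^_ m)%:Z.
Proof.
elim: m => [|m IH]; first by rewrite big_ord0.
rewrite big_ord_recr /= IH ffactnSr PoszM.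
have [mx | xm] := leqP m x; first by rewrite subzn.
by rewrite ffact_small // !mul0r.
Qed.

Lemma prod_subz_neg (x m : nat) :
  \prod_(i < m) (- x.+1%:Z - i%:Z) = (-1) ^+ m * ((x + m) ^_ m)%:Z.
Proof.
elim: m => [|m IH]; first by rewrite big_ord0.
rewrite big_ord_recr /= IH addnS ffactSS PoszM exprS -addSn PoszD; ring.
Qed.

Lemma binz_fact (x : int) (m : nat) :
  binz x m * (m`!)%:Z = \prod_(i < m) (x - i%:Z).
Proof.
apply: divzK; case: x => x.
  by rewrite prod_subz_nat -bin_ffact PoszM dvdz_mull.
by rewrite NegzE prod_subz_neg -bin_ffact PoszM mulrA dvdz_mull.
Qed.

Lemma binz_nat (x m : nat) : binz x%:Z m = 'C(x, m)%:Z.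
Proof.
by rewrite /binz prod_subz_nat -bin_ffact PoszM mulzK // eqz_nat -lt0n fact_gt0.
Qed.

(* Main.v *)
Require Import Defs.
From HB Require Import structures.
From mathcomp Require Import all_boot all_order all_algebra.
From mathcomp Require Import ring zify.

(* Splitting the factors of C(kp, rp) according to divisibility by p gives, for
   p odd,
     C(kp, rp) = C(k, r) \prod_(0 < j < p) f(p / j),
     f(T) = \prod_(b < r) (1 + (b - k) T) / (1 + b T) = \sum_i c_i T^i,
   with integers c_i and c_0 = 1.  Expanding the product over j term by term gives
     \prod_(j <= N) f(p / j) = \sum_s c_(s_1) ... c_(s_l) p^(w(s)) H_N(s),
   so alpha_s = C(k, r) c_(s_1) ... c_(s_l).  Both f and the sum over s are
   truncated, and the expansion is proved modulo p^n by induction on N. *)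

Import GRing.Theory.
Local Open Scope ring_scope.

Set Implicit Arguments.
Unset Strict Implicit.
Unset Printing Implicit Defensive.

Import Order.TTheory Num.Theory.

(** * The ring of p-integral rationals *)

Lemma p_integralP (p : nat) (q : rat) :
  reflect (exists2 d : int, ~~ (p %| `|d|)%N & exists m : int, q * d%:~R = m%:~R)
          (p_integral p q).
Proof.
apply: (iffP idP) => [pq | [d pd [m qd]]].
  by exists (denq q) => //; exists (numq q); rewrite numqE.
rewrite /p_integral; apply: contra pd => /dvdn_trans; apply.
have: (denq q %| numq q * d)%Z.
  apply/dvdzP; exists m; apply: (intr_inj (R := rat)).
  by rewrite !rmorphM /= -qd numqE; ring.
by rewrite Gauss_dvdzr // coprimez_sym; exact: coprime_num_den.
Qed.

(* A prime argument lets the subring structure be inferred. *)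
Definition local_int (p : nat) (pp : prime p) : {pred rat} := p_integral p.

Fact local_int_subring (p : nat) (pp : prime p) : subring_closed (local_int pp).
Proof.
split=> [|x y|x y].
- by apply/p_integralP; exists 1; [rewrite dvdn1; case: p pp => [|[]] | exists 1].
- move=> /p_integralP[d pd [m xd]] /p_integralP[e pe [l ye]].
  apply/p_integralP; exists (d * e); first by rewrite abszM Euclid_dvdM // negb_or pd.
  exists (m * e - l * d); rewrite rmorphB /= !rmorphM /= -xd -ye; ring.
move=> /p_integralP[d pd [m xd]] /p_integralP[e pe [l ye]].
apply/p_integralP; exists (d * e); first by rewrite abszM Euclid_dvdM // negb_or pd.
exists (m * l); rewrite !rmorphM /= -xd -ye; ring.
Qed.

HB.instance Definition _ (p : nat) (pp : prime p) :=
  GRing.isSubringClosed.Build rat (local_int pp) (local_int_subring pp).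

Lemma local_int_inv_nat (p : nat) (pp : prime p) (j : nat) :
  (0 < j < p)%N -> j%:R^-1 \in local_int pp.
Proof.
case/andP=> j0 jp; apply/p_integralP; exists j%:Z; first by rewrite gtnNdvd.
by exists 1; rewrite mulVf // pnatr_eq0 -lt0n.
Qed.

(** If x = m / d with d prime to p, then 1 + p x = (d + p m) / d, and its numerator is again prime
    to p. *)
Lemma local_int_unit (p : nat) (pp : prime p) (x : rat) : x \in local_int pp ->
  1 + p%:R * x != 0 /\ (1 + p%:R * x)^-1 \in local_int pp.
Proof.
move=> /p_integralP[d pd [m xd]].
set e : int := d + p%:Z * m.
have xE : (1 + p%:R * x) * d%:~R = e%:~R.
  by rewrite rmorphD rmorphM /= -xd; ring.
have pe : ~~ (p %| `|e|)%N.
  apply: contra pd; rewrite -[(p %| _)%N]/(p%:Z %| e)%Z -[(p %| `|d|)%N]/(p%:Z %| d)%Z.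
  by rewrite rpredDr // dvdz_mulr.
have n0 : 1 + p%:R * x != 0.
  apply: contraNneq pe => x0; move: xE; rewrite x0 mul0r => /esym/eqP.
  by rewrite intr_eq0 => /eqP->.
split=> //; apply/p_integralP; exists e => //.
by exists d; rewrite -xE mulKf.
Qed.

(** * Congruences between rationals modulo p^n *)

Definition rat_eqmod (p n : nat) (x y : rat) : bool :=
  p_integral p ((x - y) / p%:R ^+ n).

Section RatCongruence.
Variables (p n : nat) (pp : prime p).
Implicit Types x y z : rat.

Lemma rat_eqmodE x y :
  rat_eqmod p n x y = ((x - y) / p%:R ^+ n \in local_int pp).
Proof. by []. Qed.

Lemma rat_eqmod_trans y x z :
  rat_eqmod p n x y -> rat_eqmod p n y z -> rat_eqmod p n x z.
Proof.
rewrite !rat_eqmodE => xy yz; rewrite -[x](subrK y) -addrA mulrDl; exact: rpredD.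
Qed.

Lemma rat_eqmod_sym x y : rat_eqmod p n x y -> rat_eqmod p n y x.
Proof. by rewrite !rat_eqmodE -[y - x]opprB mulNr rpredN. Qed.

Lemma rat_eqmodMl z x y : z \in local_int pp ->
  rat_eqmod p n x y -> rat_eqmod p n (z * x) (z * y).
Proof. by rewrite !rat_eqmodE -mulrBr -mulrA => *; apply: rpredM. Qed.

Lemma rat_eqmodMr z x y : z \in local_int pp ->
  rat_eqmod p n x y -> rat_eqmod p n (x * z) (y * z).
Proof. by move=> *; rewrite ![_ * z]mulrC; apply: rat_eqmodMl. Qed.

Lemma rat_eqmod_refl x : rat_eqmod p n x x.
Proof. by rewrite rat_eqmodE subrr mul0r rpred0. Qed.

(** Multiplying a congruence by a factor preserves it when that factor is p-integral, so the [F j]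
    can be exchanged for the [G j] one at a time. *)
Lemma rat_eqmod_prod (m : nat) (F G : nat -> rat) :
  (forall j, (j < m)%N -> F j \in local_int pp) ->
  (forall j, (j < m)%N -> G j \in local_int pp) ->
  (forall j, (j < m)%N -> rat_eqmod p n (F j) (G j)) ->
  rat_eqmod p n (\prod_(j < m) F j) (\prod_(j < m) G j).
Proof.
elim: m => [|m IH] iF iG FG; first by rewrite !big_ord0 rat_eqmod_refl.
rewrite !big_ord_recr /=.
apply: (@rat_eqmod_trans ((\prod_(j < m) F j) * G m)).
  apply: rat_eqmodMl (FG m (leqnn _)).
  by apply: rpred_prod => j _; apply: iF; rewrite ltnS ltnW.
apply: rat_eqmodMr; first exact: iG.
by apply: IH => j jm; [apply: iF | apply: iG | apply: FG]; rewrite ltnS ltnW.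
Qed.

End RatCongruence.

(** * Division of power series *)

Section PowerSeriesQuotient.
Variables (R : comNzRingType) (P Q : {poly R}).

(** Long division by increasing powers: if [Q] has constant term 1, the subtraction cancels the
    constant term and [drop_poly 1] divides by X. Then [series_quo n] is the coefficient of X^n in P
    / Q. *)
Fixpoint series_rem (n : nat) : {poly R} :=
  if n is m.+1 then drop_poly 1 (series_rem m - (series_rem m)`_0 *: Q) else P.

Definition series_quo (n : nat) : R := (series_rem n)`_0.

(** The invariant of the division. As an identity of polynomials it can be evaluated at a point,
    with an explicit error term. *)
Lemma series_divE (n : nat) : Q`_0 = 1 ->
  P = Q * \sum_(i < n) series_quo i *: 'X^i + series_rem n * 'X^n.
Proof.
move=> Q0; elim: n => [|n IH]; first by rewrite big_ord0 mulr0 add0r mulr1.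
rewrite big_ord_recr /= mulrDr -addrA {1}IH; congr (_ + _).
set S := series_rem n; set T := S - _.
have TX : drop_poly 1 T * 'X = T.
  rewrite -{2}(poly_take_drop 1 T) [take_poly 1 T](_ : _ = 0) ?add0r //.
  apply/polyP=> i; rewrite coef_take_poly coef0; case: i => //=.
  by rewrite coefB coefZ Q0 mulr1 subrr.
rewrite exprS mulrA TX /T mulrBl -scalerAl -scalerAr /series_quo -/S; ring.
Qed.

End PowerSeriesQuotient.

(** * Recursion for multiple harmonic sums *)

Lemma big_tuple_cons (R : Type) (idx : R) (op : Monoid.com_law idx) (T : finType) (k : nat)
    (P : pred (k.+1.-tuple T)) (F : k.+1.-tuple T -> R) :
  \big[op/idx]_(t : k.+1.-tuple T | P t) F t =
  \big[op/idx]_(x : T) \big[op/idx]_(t : k.-tuple T | P (cons_tuple x t)) F (cons_tuple x t).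
Proof.
rewrite pair_big_dep /=.
rewrite (reindex (fun u : T * k.-tuple T => cons_tuple u.1 u.2)) //=.
exists (fun t => (thead t, behead_tuple t)) => [[x t] _ | t _] /=.
  by congr pair; apply: val_inj.
by case/tupleP: t => x t; apply: val_inj.
Qed.

(* Chains bounded by N, with entries drawn from any 'I_M with N < M: keeping the
   entry type independent of N makes the recursion on the head possible. *)
Definition mhs_in (M N : nat) (s : seq nat) : rat :=
  \sum_(t : (size s).-tuple 'I_M
        | path gtn N.+1 (map val t) && all (leq 1) (map val t))
     \prod_(i < size s) (tnth t i : nat)%:R ^- nth 0%N s i.

Lemma mhsE (N : nat) (s : seq nat) : mhs N s = mhs_in N.+1 N s.
Proof.
apply: eq_bigl => t; congr (_ && _); case: t => -[|x t] //= _.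
by rewrite ltn_ord.
Qed.

Lemma mhs_in_nil (M N : nat) : mhs_in M N [::] = 1.
Proof.
rewrite /mhs_in (big_pred1 [tuple]); first by rewrite big_ord0.
by move=> t; rewrite (tuple0 t) /=.
Qed.

Lemma mhs_in_cons (M N a : nat) (s : seq nat) : (N < M)%N ->
  mhs_in M N (a :: s) = \sum_(j < N) j.+1%:R ^- a * mhs_in M j s.
Proof.
move=> NM; rewrite /mhs_in big_tuple_cons /=.
(* Here [x] is the largest entry n_1; the later ones lie strictly below it, so the tail has bound
   [x.-1]. *)
transitivity (\sum_(x < M | (0 < x < N.+1)%N) (x : nat)%:R ^- a * mhs_in M x.-1 s).
  rewrite [RHS]big_mkcond /=; apply: eq_bigr => x _.
  case: ifP => [/andP[x0 xN] | xN].
    rewrite /mhs_in big_distrr /=; apply: eq_big => [t|t _].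
      by rewrite (prednK x0) /= x0; move: xN => ->.
    rewrite big_ord_recl /=; congr (_ * _); apply: eq_bigr => i _.
    by rewrite tnthS.
  rewrite big_pred0 // => t; apply: contraFF xN.
  by case/andP=> /andP[xN _] /andP[x0 _]; rewrite x0 -ltnS.
rewrite -(big_ord_widen_cond M (fun x => 0 < x)%N (fun x => x%:R ^- a * mhs_in M x.-1 s)) //.
by rewrite big_mkcond big_ord_recl /= add0r.
Qed.

Lemma mhs_in_indep (s : seq nat) (M M' N : nat) : (N < M)%N -> (N < M')%N ->
  mhs_in M N s = mhs_in M' N s.
Proof.
elim: s M M' N => [|a s IH] M M' N NM NM'; first by rewrite !mhs_in_nil.
rewrite !mhs_in_cons //; apply: eq_bigr => j _; congr (_ * _).
by apply: IH; [exact: ltn_trans NM | exact: ltn_trans NM'].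
Qed.

Lemma mhs_cons (N a : nat) (s : seq nat) :
  mhs N (a :: s) = \sum_(j < N) j.+1%:R ^- a * mhs j s.
Proof.
rewrite mhsE mhs_in_cons //; apply: eq_bigr => j _; rewrite mhsE; congr (_ * _).
by apply: mhs_in_indep => //; rewrite ltnS ltnW.
Qed.

(** A nonempty composition is a first part and a tail. Tails come from the full list and are
    filtered by weight afterwards, so that they can be compared with the product of a sum over [a]
    and a sum over [s]. *)
Lemma perm_compositions_lt (n : nat) :
  perm_eq (compositions_lt n.+1)
    ([::] :: [seq x.1 :: x.2 |
       x <- [seq (a, s) | a <- iota 1 n, s <- compositions_lt n.+1]
       & (x.1 + weight x.2 < n.+1)%N]).
Proof.
apply: uniq_perm; first exact: uniq_compositions_lt.
  rewrite /= map_inj_in_uniq ?filter_uniq ?allpairs_uniq ?iota_uniq ?uniq_compositions_lt //.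
  - by rewrite andbT; apply/mapP=> -[].
  - by move=> [? ?] [? ?].
  - by move=> [? ?] [? ?] _ _ /= [-> ->].
move=> s; rewrite mem_compositions_lt inE; case: s => [|a s] //=.
apply/idP/mapP => [/andP[/andP[a1 cs] ws] | [[b t] /=]].
  exists (a, s) => //; rewrite mem_filter ws /=.
  apply/allpairsP; exists (a, s); split=> //=; last rewrite mem_compositions_lt cs /=.
    by rewrite mem_iota a1 /=; move: ws; rewrite /weight /=; lia.
  by move: ws; rewrite /weight /=; lia.
rewrite mem_filter /= => /andP[wt /allpairsP[[b' t'] /= [bi ti [? ?]]]] [? ?]; subst.
move: ti bi; rewrite mem_compositions_lt mem_iota => /andP[ct _] /andP[b1 _].
by rewrite /= b1; apply/andP; split.
Qed.

(** * Expansion of the truncated product *)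

Section TruncatedProduct.
Variables (p : nat) (pp : prime p) (c : nat -> int).

Let pn0 : p%:R != 0 :> rat.
Proof. by rewrite pnatr_eq0 -lt0n prime_gt0. Qed.

Lemma mhs_local_int (N : nat) (s : seq nat) : (N < p)%N -> mhs N s \in local_int pp.
Proof.
elim: s N => [|a s IH] N Np; first by rewrite mhs_nil rpred1.
rewrite mhs_cons; apply: rpred_sum => j _.
have jp : (j.+1 < p)%N by exact: leq_ltn_trans Np.
rewrite -exprVn; apply: rpredM; last by apply: IH; apply: ltnW.
by apply: rpredX; apply: local_int_inv_nat.
Qed.

Definition mhs_term (N : nat) (s : seq nat) : rat :=
  \prod_(a <- s) (c a)%:~R * p%:R ^+ weight s * mhs N s.

(** The chains new at bound [N.+1] start with the entry [N.+1], and their tails are bounded by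
    [N]. *)
Lemma mhs_term_cons (N a : nat) (s : seq nat) :
  mhs_term N.+1 (a :: s) =
  mhs_term N (a :: s) + (c a)%:~R * (p%:R / N.+1%:R) ^+ a * mhs_term N s.
Proof.
rewrite /mhs_term mhs_cons big_ord_recr -mhs_cons big_cons /= /weight /=.
rewrite exprD expr_div_n; ring.
Qed.

Lemma sum_mhs_term_S (n N : nat) :
  \sum_(s <- compositions_lt n.+1) mhs_term N.+1 s =
  \sum_(s <- compositions_lt n.+1) mhs_term N s +
  \sum_(1 <= a < n.+1) \sum_(s <- compositions_lt n.+1 | (a + weight s < n.+1)%N)
     (c a)%:~R * (p%:R / N.+1%:R) ^+ a * mhs_term N s.
Proof.
(* The empty composition contributes 1 at every bound; only compositions with a first part [a]
   change. *)
have E M : \sum_(s <- compositions_lt n.+1) mhs_term M s = 1 +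
    \sum_(1 <= a < n.+1) \sum_(s <- compositions_lt n.+1 | (a + weight s < n.+1)%N)
      mhs_term M (a :: s).
  rewrite (perm_big _ (perm_compositions_lt n)) big_cons big_map big_filter.
  rewrite {1}/mhs_term big_nil mhs_nil !mulr1 big_mkcond big_allpairs /=.
  rewrite /index_iota subn1; congr (_ + _); apply: eq_bigr => a _.
  by rewrite [RHS]big_mkcond.
rewrite !E -addrA -big_split; congr (_ + _); apply: eq_bigr => a _.
by rewrite -big_split; apply: eq_bigr => s _; rewrite mhs_term_cons.
Qed.

(** With y = p / (N+1), the step to N+1 multiplies the left side by the sum of all c_a y^a, a <= n.
    The right side gains c_a y^a times the term of s only when a + w(s) <= n. *)
Lemma prod_mhs_eqmod (n N : nat) : c 0 = 1 -> (N < p)%N ->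
  rat_eqmod p n.+1
    (\prod_(j < N) \sum_(i < n.+1) (c i)%:~R * (p%:R / j.+1%:R) ^+ i)
    (\sum_(s <- compositions_lt n.+1) mhs_term N s).
Proof.
move=> c0; elim: N => [|N IH] Np.
  rewrite big_ord0 (perm_big _ (perm_compositions_lt n)) big_cons big_map big1.
    by rewrite Monoid.mulm1 /mhs_term big_nil mhs_nil !mulr1; exact: (rat_eqmod_refl n.+1 pp).
  by move=> x _; rewrite /mhs_term mhs_cons big_ord0 mulr0.
set y : rat := p%:R / N.+1%:R.
have zI : N.+1%:R^-1 \in local_int pp by exact: local_int_inv_nat.
have yI : y \in local_int pp by rewrite rpredM ?rpred_nat.
rewrite big_ord_recr /= -/y sum_mhs_term_S.
set S := \sum_(s <- compositions_lt _) _ in IH *.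
rewrite -/y; set f := \sum_(i < n.+1) (c i)%:~R * y ^+ i.
apply: (@rat_eqmod_trans _ _ pp (S * f)).
  apply: (rat_eqmodMr (pp := pp) _ (IH (ltnW Np))).
  by apply: rpred_sum => i _; rewrite rpredM ?rpredX ?rpred_int.
have -> : f = 1 + \sum_(1 <= a < n.+1) (c a)%:~R * y ^+ a.
  rewrite /f -(big_mkord xpredT (fun i => (c i)%:~R * y ^+ i)) big_ltn //.
  by rewrite c0 mul1r.
rewrite (rat_eqmodE _ pp) mulrDr mulr1 opprD addrACA subrr add0r mulr_sumr -sumrB mulr_suml.
(* What is left are the terms with a + weight s > n, all divisible by p ^ n.+1. *)
apply: rpred_sum => a _.
rewrite [S * _]mulrC /S mulr_sumr (bigID (fun s => (a + weight s < n.+1)%N)) /= addrAC subrr add0r.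
rewrite mulr_suml; apply: rpred_sum => s; rewrite -leqNgt => ws.
rewrite (_ : _ / _ = (c a)%:~R * N.+1%:R^-1 ^+ a * \prod_(a <- s) (c a)%:~R * mhs N s
    * (p%:R ^+ (a + weight s) / p%:R ^+ n.+1)); last first.
  by rewrite /mhs_term /y exprMn exprD; ring.
rewrite -expfB_cond ?(negbTE pn0) //.
rewrite !rpredM ?rpredX ?rpred_int ?rpred_nat ?mhs_local_int ?(ltnW Np) //.
by apply: rpred_prod => i _; rewrite rpred_int.
Qed.

End TruncatedProduct.

(** * Truncation of f *)

Lemma local_int_horner (p : nat) (pp : prime p) (P : {poly int}) (y : rat) :
  y \in local_int pp -> (map_poly intr P).[y] \in local_int pp.
Proof.
move=> yI; rewrite horner_coef; apply: rpred_sum => i _.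
by rewrite coef_map rpredM ?rpredX ?rpred_int.
Qed.

(* The error term of the truncation is a multiple of y ^+ n = p ^ n z ^ n. *)
Lemma series_quo_eqmod (p n : nat) (pp : prime p) (P Q : {poly int}) (z : rat) :
  Q`_0 = 1 -> z \in local_int pp -> let y := p%:R * z in
  let f := (map_poly intr P).[y] / (map_poly intr Q).[y] in
  f \in local_int pp /\
  rat_eqmod p n f (\sum_(i < n) (series_quo P Q i)%:~R * y ^+ i).
Proof.
move=> Q0 zI y f.
have pn0 : p%:R != 0 :> rat by rewrite pnatr_eq0 -lt0n prime_gt0.
have yI : y \in local_int pp by rewrite rpredM ?rpred_nat.
(* Constant term 1 and y = p z put Q(y) in the form required by [local_int_unit]. *)
have QE : (map_poly intr Q).[y] = 1 + p%:R * ((map_poly intr (drop_poly 1 Q)).[y] * z).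
  rewrite -{1}(poly_take_drop 1 Q) rmorphD rmorphM /= map_polyX hornerD hornerM hornerX.
  have -> : take_poly 1 Q = 1.
    by apply/polyP=> i; rewrite coef_take_poly coef1; case: i.
  by rewrite rmorph1 hornerE /y; ring.
have [Qn0 QI] := local_int_unit (rpredM (local_int_horner (drop_poly 1 Q) yI) zI).
rewrite -QE in Qn0 QI.
split; first by rewrite rpredM ?local_int_horner.
have PE := congr1 (fun T : {poly int} => (map_poly intr T).[y]) (series_divE P n Q0).
rewrite /= rmorphD !rmorphM /= map_polyXn rmorph_sum /= !hornerE horner_sum in PE.
rewrite (rat_eqmodE _ pp) /f PE.
under eq_bigr do rewrite map_polyZ map_polyXn !hornerE.
set s := \sum_(i < n) _; set R := (map_poly _ (series_rem _ _ _)).[y].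
rewrite (_ : _ / _ = R * z ^+ n * ((map_poly intr Q).[y])^-1).
  by rewrite !rpredM ?rpredX ?local_int_horner.
by rewrite /y exprMn; field; rewrite Qn0 expf_neq0.
Qed.

(** * Factorization of the binomial coefficient *)

Lemma big_ord_mul (R : Type) (idx : R) (op : Monoid.law idx) (m q : nat) (F : nat -> R) :
  \big[op/idx]_(i < m * q) F i =
  \big[op/idx]_(b < m) \big[op/idx]_(j < q) F (b * q + j)%N.
Proof.
rewrite -(big_mkord xpredT F) big_nat_mul big_mkord; apply: eq_bigr => b _.
rewrite mulSn -{1}[(b * q)%N]add0n big_addn addnK big_mkord.
by apply: eq_bigr => j _; rewrite addnC.
Qed.

Lemma natr_fact (R : pzSemiRingType) (n : nat) : n`!%:R = \prod_(i < n) i.+1%:R :> R.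
Proof.
rewrite fact_prod natr_prod (big_addn 0 _ 1) subn1 big_mkord.
by apply: eq_bigr => i _; rewrite addn1.
Qed.

Lemma binz_mul (k : int) (r q : nat) : ~~ odd q ->
  (binz (k * q.+1%:Z) (r * q.+1))%:~R =
  (binz k r)%:~R * \prod_(j < q) \prod_(b < r)
    ((1 + (b%:Z - k)%:~R * (q.+1%:R / j.+1%:R)) / (1 + b%:R * (q.+1%:R / j.+1%:R))) :> rat.
Proof.
move=> oq; have fact0 m : m`!%:R != 0 :> rat by rewrite pnatr_eq0 -lt0n fact_gt0.
have binzE x m : (binz x m)%:~R * m`!%:R = \prod_(i < m) (x - i%:Z)%:~R :> rat.
  by rewrite -rmorph_prod -binz_fact rmorphM.
apply: (mulIf (fact0 (r * q.+1)%N)); rewrite binzE.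
have -> : (r * q.+1)`!%:R = r`!%:R *
    \prod_(b < r) (q.+1%:R * \prod_(j < q) (b * q.+1 + j.+1)%:R) :> rat.
  rewrite !natr_fact (big_ord_mul _ _ _ (fun i => i.+1%:R)) -big_split /=; apply: eq_bigr => b _.
  rewrite big_ord_recr /= -addnS -mulSnr natrM [LHS]mulrC -mulrA; do 2 congr (_ * _).
  by apply: eq_bigr => j _; rewrite addnS.
(* The factors with index divisible by q.+1 give binz k r; the others are paired
   with the factor of the factorial in the same block and at the same offset. *)
rewrite mulrACA binzE exchange_big -!big_split /=.
rewrite (big_ord_mul _ _ _ (fun i => (k * q.+1 - i%:Z)%:~R)); apply: eq_bigr => b _.
rewrite big_ord_recl [RHS]mulrA [RHS]mulrACA; congr (_ * _).
  by rewrite addn0 PoszM -mulrBl rmorphM.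
(* The numerator factor (k-b)(q+1) - (j+1) is minus (j+1) + (b-k)(q+1); each block has q such signs,
   an even number. *)
have sgn : \prod_(j < q) (-1) = 1 :> rat.
  by rewrite prodr_const card_ord -signr_odd (negbTE oq).
rewrite -[RHS]mul1r -[X in _ = X * _]sgn -!big_split; apply: eq_bigr => j _ /=.
have j0 : j.+1%:R != 0 :> rat by rewrite pnatr_eq0.
have d0 : j.+1%:R + b%:R * q.+1%:R != 0 :> rat by rewrite -natrM -natrD pnatr_eq0.
rewrite /bump /= add1n PoszD PoszM !rmorphB rmorphM rmorphD rmorphM /= natrD natrM.
by field; rewrite !nat1r j0 d0.
Qed.

Lemma padic_eqmod_of_int (p n : nat) (pp : prime p) (m : int) (q : rat) :
  rat_eqmod p n q m%:~R -> padic_eqmod n (padic_of_int p m) q.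
Proof.
move=> qm; apply: (rat_eqmod_trans pp qm).
have pn0 : p%:R ^+ n != 0 :> rat by rewrite expf_neq0 // pnatr_eq0 -lt0n prime_gt0.
rewrite (rat_eqmodE _ pp) /= {1}(divz_eq m (p%:Z ^+ n)) -rmorphB /= addrK.
by rewrite rmorphM rmorphXn /= mulfK // rpred_int.
Qed.

(** * Choice of the coefficients and conclusion *)

Theorem theorem5 (k r : int) (hr : 0 <= r) :
  asymptotically_representable
    (fun p : nat => padic_of_int p (binz (k * p%:Z) (`|r| * p)%N)).
Proof.
set m := `|r|%N.
(* Both the numerator [P] and the denominator [Q] of f have this shape, so constant term 1. *)
pose L (f : 'I_m -> int) : {poly int} := \prod_b (1 + (f b)%:P * 'X).
have L0 f : (L f)`_0 = 1.
  by rewrite -horner_coef0 horner_prod big1 // => b _; rewrite !hornerE.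
have LE f (y : rat) : (map_poly intr (L f)).[y] = \prod_b (1 + (f b)%:~R * y).
  rewrite rmorph_prod horner_prod; apply: eq_bigr => b _.
  by rewrite rmorphD rmorph1 rmorphM /= map_polyC map_polyX !hornerE.
pose P := L (fun b => b%:Z - k); pose Q := L (fun b => b%:Z).
pose c := series_quo P Q; have c0 : c 0 = 1 by exact: L0.
exists (fun s => (binz k m)%:~R * \prod_(a <- s) (c a)%:~R) => n n1.
(* The bound 3 excludes p = 2, making p - 1 even; it serves for every n. *)
exists 3%N => p pp p3; apply: padic_eqmod_of_int => //.
have [q pq] : exists q, p = q.+1 by case: p pp {p3} => // q; exists q.
have oq : ~~ odd q by case: (even_prime pp) p3 => [->|] //; rewrite pq.
have -> : (binz (k * p%:Z) (m * p))%:~R = (binz k m)%:~R * \prod_(j < q)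
    ((map_poly intr P).[p%:R / j.+1%:R] / (map_poly intr Q).[p%:R / j.+1%:R]) :> rat.
  rewrite pq binz_mul //; congr (_ * _); apply: eq_bigr => j _.
  by rewrite !LE big_split prodfV.
rewrite (eq_bigr (fun s => (binz k m)%:~R * mhs_term p c p.-1 s)); last first.
  by move=> s _; rewrite /mhs_term !mulrA.
rewrite -mulr_sumr; apply: (rat_eqmodMl (pp := pp)); first exact: rpred_int.
have -> : p.-1 = q by rewrite pq.
case: n n1 => // n _.
have qp : (q < p)%N by rewrite pq.
(* Take z = 1 / (j+1), which is p-integral because j + 1 <= q < p. *)
have h j : (j < q)%N -> _ := fun jq => series_quo_eqmod n.+1 P (L0 (fun b => b%:Z))
  (local_int_inv_nat pp (j := j.+1) (leq_ltn_trans jq qp)).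
apply: (rat_eqmod_sym pp); apply: rat_eqmod_trans (prod_mhs_eqmod pp n c0 qp) => //.
apply: (rat_eqmod_prod (pp := pp)
  (F := fun j => (map_poly intr P).[p%:R / j.+1%:R] / (map_poly intr Q).[p%:R / j.+1%:R])
  (G := fun j => \sum_(i < n.+1) (c i)%:~R * (p%:R / j.+1%:R) ^+ i)) => j jq.
- by have [] := h j jq.
- apply: rpred_sum => i _.
  by rewrite !rpredM ?rpredX ?rpred_int ?rpredM ?rpred_nat ?local_int_inv_nat // (leq_ltn_trans jq).
- by have [] := h j jq.
Qed.
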